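(* Let $\mathbf{T}=(T_1,\dots,T_n)\in\mathcal{B}_A(\mathcal{H})^n$. Then $$\omega_A^2(\mathbf{T})\le\inf_{\alpha,\beta}\frac{\sqrt n}{\alpha+\beta}\Big\{\omega_A\Big(\big(\tfrac{\alpha}{4}+\beta\big)\mathbf{T}^{\sharp_A}\mathbf{T}+\tfrac{\alpha}{4}\mathbf{T}\mathbf{T}^{\sharp_A}\Big)+\tfrac{\alpha}{2}\,\omega_A(\mathbf{T}^2)\Big\}\le\sqrt n\Big(\tfrac14\,\omega_A\big(\mathbf{T}^{\sharp_A}\mathbf{T}+\mathbf{T}\mathbf{T}^{\sharp_A}\big)+\tfrac12\,\omega_A(\mathbf{T}^2)\Big),$$ where the infimum is over all reals $\alpha,\beta\ge0$ with $(\alpha,\beta)\ne(0,0)$.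
   Context: $\mathcal{H}$ is a non-trivial complex Hilbert space, $\mathcal{B}(\mathcal{H})$ the bounded linear operators on it, $A\in\mathcal{B}(\mathcal{H})$ a fixed positive operator ($\langle Ax,x\rangle\ge0$ for all $x$), $n\ge 1$ an integer. Put $\langle x,y\rangle_A=\langle Ax,y\rangle$ and $\|x\|_A=\langle Ax,x\rangle^{1/2}$. $\mathcal{B}_A(\mathcal{H})$ is the set of $T\in\mathcal{B}(\mathcal{H})$ for which there is $W\in\mathcal{B}(\mathcal{H})$ with $AW=T^*A$ (equivalently, $\mathcal{R}(T^*A)\subseteq\mathcal{R}(A)$); for such $T$, $T^{\sharp_A}=A^\dagger T^*A$ ($A^\dagger$ the Moore–Penrose inverse) is the unique bounded $W$ with $AW=T^*A$ and $\mathcal{R}(W)\subseteq\overline{\mathcal{R}(A)}$. Every $T\in\mathcal{B}_A(\mathcal{H})$ satisfies $\|Tx\|_A\le c\|x\|_A$ for all $x$, for some $c>0$. $\mathcal{B}_A(\mathcal{H})^n$ is the set of $n$-tuples of elements of $\mathcal{B}_A(\mathcal{H})$; sums, scalar multiples and products of tuples are componentwise (so $\mathbf{T}^2=(T_1^2,\dots,T_n^2)$), and $\mathbf{T}^{\sharp_A}=(T_1^{\sharp_A},\dots,T_n^{\sharp_A})$. For a tuple $\mathbf{T}$, $\omega_A(\mathbf{T})=\sup_{\|x\|_A=1}\big(\sum_{k=1}^n|\langle T_kx,x\rangle_A|^2\big)^{1/2}$. *)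

(* Defs.v *)
From HB Require Import structures.
From mathcomp Require Import all_boot all_order all_algebra.
From mathcomp Require Import all_classical all_reals all_analysis.
From mathcomp Require Import complex.

Set Implicit Arguments.
Unset Strict Implicit.
Unset Printing Implicit Defensive.

Import Order.TTheory GRing.Theory Num.Theory.
Import numFieldNormedType.Exports.

Local Open Scope classical_set_scope.
Local Open Scope ring_scope.
Local Open Scope complex_scope.

(* A complex Hilbert space is a complete normed R[i]-module H together with a
   positive definite Hermitian form dot, linear in its first argument, which
   induces the norm. Operators are plain functions H -> H, so that sums and
   scalar multiples of operators, and of n-tuples 'I_n -> (H -> H) of operators,
   are the pointwise ones of the library. *)

Section Operators.
Variables (R : realType) (H : completeNormedModType R[i]).

Definition is_hilbert (dot : {dot H for Num.conj}) : Prop :=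
  forall x : H, dot x x = `|x| ^+ 2.

Definition bounded_operator (T : H -> H) : Prop :=
  linear T /\ exists M : R[i], forall x, `|T x| <= M * `|x|.

Variable dot : {dot H for Num.conj}.

Definition orthogonal_complement (S : set H) : set H :=
  [set x | forall y, S y -> dot x y = 0].

(* The value at y is the unique z such that <T x, y> = <x, z> for all x; it
   exists for every y when T is bounded, by the Riesz representation theorem. *)
Definition adjoint (T : H -> H) (y : H) : H :=
  xget 0 [set z | forall x, dot (T x) y = dot x z].

(* The Moore-Penrose inverse of a bounded A has domain R(A) + R(A)^\perp, null
   space R(A)^\perp, and inverts A restricted to N(A)^\perp: for y in the
   domain, its value is the unique x in N(A)^\perp with y - A x in R(A)^\perp.
   Outside the domain the value is set to 0. *)
Definition moore_penrose (A : H -> H) (y : H) : H :=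
  xget 0 [set x | orthogonal_complement (A @^-1` [set 0]) x /\
                  orthogonal_complement (range A) (y - A x)].

Definition positive_operator (A : H -> H) : Prop :=
  bounded_operator A /\ forall x, 0 <= dot (A x) x.

Definition A_bounded (A : H -> H) (T : H -> H) : Prop :=
  bounded_operator T /\
  exists W : H -> H, bounded_operator W /\ A \o W = adjoint T \o A.

Definition A_adjoint (A T : H -> H) : H -> H :=
  moore_penrose A \o adjoint T \o A.

Definition A_dot (A : H -> H) (x y : H) : R[i] := dot (A x) y.

Definition A_norm (A : H -> H) (x : H) : R := Num.sqrt (complex.Re (A_dot A x x)).

Variable n : nat.

Definition tuple_A_adjoint (A : H -> H) (T : 'I_n -> H -> H) : 'I_n -> H -> H :=
  fun k => A_adjoint A (T k).

Definition tuple_mul (S T : 'I_n -> H -> H) : 'I_n -> H -> H :=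
  fun k => S k \o T k.

(* The complex modulus `|z| is an element of R[i], whose real part is taken.
   When A = 0 there is no x with A_norm A x = 1, and the supremum of the empty
   set is 0. *)
Definition omega (A : H -> H) (T : 'I_n -> H -> H) : R :=
  sup [set Num.sqrt (\sum_(k < n) (complex.Re `|A_dot A (T k x) x|) ^+ 2)
      | x in [set x | A_norm A x = 1]].

End Operators.

(* Main.v *)
(* Write S = T^#, so that <Tx, y>_A = <x, Sy>_A. For |x|_A = 1, Buzano's
   inequality applied to Tx and Sx bounds 4 |<Tx, x>_A|^2 by
   |Tx|_A^2 + |Sx|_A^2 + 2 |<Tx, Sx>_A|, that is by
   <(ST + TS)x, x>_A + 2 |<T^2 x, x>_A|, while Cauchy-Schwarz bounds it by
   4 <STx, x>_A. Weighting the two bounds by alpha and beta, and summing over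
   the components with sum_k a_k <= sqrt n (sum_k a_k^2)^(1/2), gives the first
   inequality; alpha = 1, beta = 0 gives the second.
   The suprema have to be finite, because sup is 0 on unbounded sets: this
   follows from the A-boundedness of T and S. That S has the above property
   rests on the projection theorem and the Riesz representation theorem. *)
Require Import Defs.
From HB Require Import structures.
From mathcomp Require Import all_boot all_order all_algebra.
From mathcomp Require Import all_classical all_reals all_analysis.
From mathcomp Require Import complex.
From mathcomp Require Import ring lra.

Set Implicit Arguments.
Unset Strict Implicit.
Unset Printing Implicit Defensive.

Import Order.TTheory GRing.Theory Num.Theory.
Import numFieldNormedType.Exports.

Local Open Scope classical_set_scope.
Local Open Scope ring_scope.

(** * Positive semidefinite Hermitian forms *)

Section PositiveForms.
Variables (C : numClosedFieldType) (V : lmodType C) (q : V -> V -> C).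

(** Semidefinite rather than definite: this covers both [dot] and [A_dot dot A], and the latter
    vanishes on the kernel of [A]. *)
Definition psd_form : Prop :=
  [/\ forall y, scalar (q^~ y),
      forall x y, q y x = (q x y)^* &
      forall x, 0 <= q x x].

Hypothesis qP : psd_form.

Let qPl a x y z : q (a *: x + y) z = a * q x z + q y z.
Proof. by case: qP => q_lin _ _; exact: q_lin. Qed.

Let qC x y : q y x = (q x y)^*.
Proof. by case: qP. Qed.

Let qPr a x y z : q z (a *: x + y) = a^* * q z x + q z y.
Proof. by rewrite qC qPl rmorphD rmorphM /= -!qC. Qed.

Let qNl x y : q (- x) y = - q x y.
Proof.
have q0 : q 0 y = 0.
  by have := qPl (-1) 0 0 y; rewrite scaler0 addr0 mulN1r addNr.
by have := qPl (-1) x 0 y; rewrite scaleN1r addr0 mulN1r q0 addr0.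
Qed.

Let q_ge0 x : 0 <= q x x.
Proof. by case: qP. Qed.

Lemma psd_form_combination a x y :
  q (a *: x + y) (a *: x + y) =
  `|a| ^+ 2 * q x x + a * q x y + (a * q x y)^* + q y y.
Proof. by rewrite qPl !qPr (qC x y) normCK rmorphM; ring. Qed.

Lemma psd_form_Cauchy_Schwarz x y : `|q x y| ^+ 2 <= q x x * q y y.
Proof.
have step (s : C) : s \is Num.real ->
    0 <= s ^+ 2 * `|q x y| ^+ 2 * q x x - 2 * s * `|q x y| ^+ 2 + q y y.
  move=> sR; have := q_ge0 ((- s * (q x y)^*) *: x + y).
  have pR : s * `|q x y| ^+ 2 \is Num.real by rewrite realM ?realX ?normr_real.
  rewrite psd_form_combination.
  have -> : - s * (q x y)^* * q x y = - (s * `|q x y| ^+ 2) by rewrite normCK; ring.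
  have -> : (- (s * `|q x y| ^+ 2))^* = - (s * `|q x y| ^+ 2)
    by apply/CrealP; rewrite realN.
  rewrite normrM norm_conjC normrN exprMn real_normK //.
  by congr (0 <= _); ring.
have [qx0|qxn0] := eqVneq (q x x) 0.
  rewrite qx0 mul0r; have qyR : q y y \is Num.real by exact: ger0_real.
  have [->|nz] := eqVneq (q x y) 0; first by rewrite normr0 expr0n.
  have p_gt0 : 0 < `|q x y| ^+ 2 by rewrite exprn_gt0 // normr_gt0.
  (* This [s] is chosen to make the affine expression equal to -1. *)
  have := step ((q y y + 1) / (2 * `|q x y| ^+ 2)).
  have -> : 2 * ((q y y + 1) / (2 * `|q x y| ^+ 2)) * `|q x y| ^+ 2 = q y y + 1.
    by field; rewrite ?normr_eq0 //.
  rewrite qx0 mulr0 sub0r opprD addrAC addNr sub0r oppr_ge0 ler10.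
  move=> h; exfalso; suff: false by []; apply: h.
  by rewrite realM ?realV ?realD ?realM ?real1 ?realn ?realX ?normr_real.
have qx_gt0 : 0 < q x x by rewrite lt_def qxn0 q_ge0.
have := step (q x x)^-1; rewrite realV ger0_real // => /(_ isT).
rewrite -(pmulr_rge0 _ qx_gt0) => h.
rewrite -subr_ge0; move: h; congr (0 <= _).
by rewrite /is_true; field.
Qed.

Lemma psd_form_AGM x y : 2 * `|q x y| <= q x x + q y y.
Proof.
have h : 0 <= q x x + q y y by rewrite addr_ge0.
rewrite -(@ler_pXn2r _ 2) ?nnegrE ?mulr_ge0 // exprMn.
apply: le_trans (ler_wpM2l _ (psd_form_Cauchy_Schwarz x y)) _; first by rewrite exprn_ge0.
rewrite -subr_ge0.
have -> : (q x x + q y y) ^+ 2 - 2 ^+ 2 * (q x x * q y y) = (q x x - q y y) ^+ 2 by ring.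
by rewrite -realEsqr rpredB // ger0_real.
Qed.

(* Reflecting a in the line of e preserves its length, and the reflected vector
   2 <a, e> e - a has inner product 2 <a, e> <e, b> - <a, b> with b. *)
Lemma psd_form_Buzano e a b : q e e = 1 ->
  4 * `|q a e * q e b| <= q a a + q b b + 2 * `|q a b|.
Proof.
move=> e1; pose u := (2 * q a e) *: e + - a.
have norm2M (x : C) : `|2 * x| = 2 * `|x| by rewrite normrM ger0_norm.
have quu : q u u = q a a.
  have -> : q u u = `|2 * q a e| ^+ 2 * q e e + 2 * q a e * q e (- a)
      + (2 * q a e * q e (- a))^* + q (- a) (- a) by rewrite -psd_form_combination.
  have qr x : q x (- a) = - q x a by rewrite qC qNl rmorphN /= -qC.
  have -> : 2 * q a e * q e (- a) = - (2 * `|q a e| ^+ 2).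
    by rewrite qr (qC a e) normCK; ring.
  have -> : (- (2 * `|q a e| ^+ 2))^* = - (2 * `|q a e| ^+ 2).
    by apply/CrealP; rewrite realN realM ?realn ?realX ?normr_real.
  by rewrite e1 qr qNl norm2M; ring.
have : 2 * `|q a e * q e b| <= `|q u b| + `|q a b|.
  have -> : 2 * `|q a e * q e b| = `|q u b + q a b|.
    by rewrite qPl qNl subrK -mulrA norm2M.
  exact: ler_normD.
(* After doubling, [psd_form_AGM] bounds [2 * |q u b|] by [q u u + q b b], and [q u u = q a a]. *)
move=> /(ler_wpM2l (ler0n _ 2)); rewrite mulrA -natrM mulrDr => /le_trans; apply.
by rewrite lerD2r -quu; exact: psd_form_AGM.
Qed.

End PositiveForms.

Local Open Scope complex_scope.

(** * Orthogonal projection, Riesz representation, adjoints and the Moore-Penrose inverse *)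

Section HilbertSpaces.
Variables (R : realType) (H : completeNormedModType R[i]).

(** The norm of [H] takes values in [R[i]]; moving it to [R] makes the total order, infima and [lra]
    available. *)
Definition real_norm (x : H) : R := complex.Re `|x|.

Local Notation nr := real_norm.

Lemma real_normE x : `|x| = (nr x)%:C.
Proof. by rewrite /nr RRe_real ?normr_real. Qed.

Lemma real_norm_ge0 x : 0 <= nr x.
Proof. by rewrite -ler0c -real_normE. Qed.

Lemma ler_real_normD x y : nr (x + y) <= nr x + nr y.
Proof. by rewrite -lecR rmorphD /= -!real_normE ler_normD. Qed.

Lemma bounded_operator_real (T : H -> H) : bounded_operator T ->
  exists2 D : R, 0 <= D & forall x, nr (T x) <= D * nr x.
Proof.
move=> [_ [M TM]]; exists `|complex.Re M| => // x.
have := TM x; rewrite lecE => /andP[_ /le_trans]; apply.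
rewrite real_normE /=; case: M {TM} => a b /=.
by rewrite mulr0 subr0 ler_wpM2r ?real_norm_ge0 ?ler_norm.
Qed.

(** A limit point [x] has kernel points [y] arbitrarily near, and [f x = f (x - y)] is then
    arbitrarily small. The target [V] is [R[i]] for functionals and [H] for operators. *)
Lemma closed_kernel (V : normedZmodType R[i]) (f : H -> V) (D : R) :
  {morph f : x y / x - y} -> (forall x, `|f x| <= (D * nr x)%:C) ->
  closed [set x | f x = 0].
Proof.
move=> fB fD x clx /=.
have small (e : R) : 0 < e -> `|f x| <= (`|D| * e)%:C.
  move=> e0; have e0' : 0 < e%:C by rewrite ltcR.
  have [y [/= fy]] := clx _ (nbhsx_ballx x _ e0').
  rewrite -ball_normE /= real_normE ltcR => xy.
  rewrite -[f x]subr0 -fy -fB (le_trans (fD _)) // lecR.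
  rewrite (@le_trans _ _ (`|D| * nr (x - y))) //.
    by rewrite ler_wpM2r ?real_norm_ge0 ?ler_norm.
  by rewrite ler_wpM2l // ltW.
have fxE : `|f x| = (complex.Re `|f x|)%:C by rewrite RRe_real ?normr_real.
apply/eqP; rewrite -normr_le0 fxE lecR.
apply/ler_addgt0Pl => e e0; rewrite addr0.
have D1 : 0 < `|D| + 1 by rewrite ltr_wpDl.
have := small (e / (`|D| + 1)) (divr_gt0 e0 D1); rewrite fxE lecR => /le_trans; apply.
rewrite mulrA ler_pdivrMr // mulrC ler_wpM2l ?(ltW e0) // lerDl //.
Qed.

Variable dot : {dot H for Num.conj}.

Lemma dot_psd : psd_form dot.
Proof.
split=> [y a x z|x y|x]; first exact: linearPl.
  by rewrite (hermC dot y x) expr0 mul1r.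
exact: dnorm_ge0.
Qed.

Hypothesis hilbertH : is_hilbert dot.

Lemma dot_real_norm x : dot x x = (nr x ^+ 2)%:C.
Proof. by rewrite hilbertH real_normE rmorphXn. Qed.

Lemma norm_dot_le x y : `|dot x y| <= (nr x * nr y)%:C.
Proof.
rewrite -(@ler_pXn2r _ 2) ?nnegrE // ?ler0c ?mulr_ge0 ?real_norm_ge0 //.
have := psd_form_Cauchy_Schwarz dot_psd x y.
by rewrite !dot_real_norm -rmorphM -exprMn rmorphXn.
Qed.

Lemma parallelogram x y :
  nr (x + y) ^+ 2 + nr (x - y) ^+ 2 = 2 * nr x ^+ 2 + 2 * nr y ^+ 2.
Proof.
have : dot (x + y) (x + y) + dot (x - y) (x - y) =
    dot x x + dot x x + (dot y y + dot y y).
  by rewrite dnormD dnormB; ring.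
by rewrite !dot_real_norm => /(congr1 (@complex.Re R)) /= ->; ring.
Qed.

(* Points of K nearly closest to w form a Cauchy sequence by the parallelogram
   identity. *)
Lemma closest_point (K : set H) (w : H) : closed K -> K 0 ->
  (forall a x y, K x -> K y -> K (a *: x + y)) ->
  exists2 p, K p & forall y, K y -> nr (w - p) <= nr (w - y).
Proof.
move=> Kcl K0 Klin.
pose E := [set nr (w - y) ^+ 2 | y in K].
have Elb : has_lbound E by exists 0 => _ [y _ <-]; rewrite sqr_ge0.
have hE : has_inf E by split => //; exists (nr (w - 0) ^+ 2), 0.
pose d := inf E.
have dK y : K y -> d <= nr (w - y) ^+ 2 by move=> Ky; apply: ge_inf => //; exists y.
have [s sP] : {s : nat -> H & forall m, K (s m) /\ nr (w - s m) ^+ 2 < d + m.+1%:R^-1}.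
  apply: (@choice _ _ (fun m y => K y /\ nr (w - y) ^+ 2 < d + m.+1%:R^-1)) => m.
  have m0 : 0 < m.+1%:R^-1 :> R by rewrite invr_gt0.
  by have [_ [y Ky <-] lt] := inf_adherent m0 hE; exists y.
have small (e : R) : 0 < e -> exists N, forall m, (N <= m)%N -> m.+1%:R^-1 < e.
  move=> e0; have [N _ NP] := near_infty_natSinv_lt (PosNum e0).
  by exists N => m Nm; exact: NP.
have gap m k : nr (s m - s k) ^+ 2 <= 2 * m.+1%:R^-1 + 2 * k.+1%:R^-1.
  have [Km ltm] := sP m; have [Kk ltk] := sP k.
  have := parallelogram (w - s m) (w - s k).
  (* The midpoint of [s m] and [s k], with [+ 0] to match the shape of [Klin]. It lies in [K], so
     [nr (w - z) ^+ 2] is at least [d]. *)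
  pose z := 2^-1 *: s m + (2^-1 *: s k + 0).
  have Kz : K z by apply: (Klin) => //; apply: (Klin).
  have -> : w - s m + (w - s k) = 2 *: (w - z).
    rewrite /z addr0 -scalerDr scalerBr scalerA mulfV ?pnatr_eq0 // scale1r.
    by rewrite scaler_nat mulr2n opprD addrACA.
  have -> : w - s m - (w - s k) = - (s m - s k)
    by rewrite opprD opprK addrACA subrr add0r opprB addrC.
  have -> : nr (2 *: (w - z)) = 2 * nr (w - z).
    by apply: complexI; rewrite rmorphM /= -!real_normE normrZ normr_nat rmorph_nat.
  have -> : nr (- (s m - s k)) = nr (s m - s k) by rewrite /nr normrN.
  have := dK _ Kz; move: m.+1%:R^-1 k.+1%:R^-1 (nr (w - z)) ltm ltk => a b c *.
  by lra.
have cs : cvg (s @ \oo).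
  apply/cauchy_cvgP/cauchy_exP => e e0.
  have eE : e = (complex.Re e)%:C by rewrite RRe_real // gtr0_real.
  move: (complex.Re e) eE e0 => r ->; rewrite ltcR => r0.
  have [N NP] := small (r ^+ 2 / 4) (divr_gt0 (exprn_gt0 2 r0) (ltr0n _ 4)).
  exists (s N); exists N => // m /= Nm.
  rewrite -ball_normE /= real_normE ltcR -(@ltr_pXn2r _ 2) ?nnegrE ?real_norm_ge0 ?(ltW r0) //.
  by have := gap N m; have := NP _ Nm; have := NP _ (leqnn N);
  move: m.+1%:R^-1 N.+1%:R^-1 => a b *; lra.
pose p := lim (s @ \oo).
have sp : s @ \oo --> p by [].
have Kp : K p.
  by apply: (closed_cvg _ Kcl _ _ sp); near=> m; case: (sP m).
exists p => // y Ky.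
have -> : nr (w - p) <= nr (w - y) = (nr (w - p) ^+ 2 <= nr (w - y) ^+ 2).
  by rewrite ler_pXn2r ?nnegrE ?real_norm_ge0.
apply: le_trans (dK _ Ky); rewrite leNgt; apply/negP => lt.
set a := nr (w - p) in lt.
have a0 : 0 <= a by exact: real_norm_ge0.
(* Small enough that a point [v] of the sequence with [nr (p - v) < e] and [nr (w - v) ^+ 2 < d + e]
   contradicts [a <= nr (w - v) + nr (p - v)]. *)
pose e := (a ^+ 2 - d) / (2 * a + 2).
have e0 : 0 < e by rewrite divr_gt0; lra.
have eE : (2 * a + 2) * e = a ^+ 2 - d by rewrite /e mulrC divfK // gt_eqF; lra.
have e0' : 0 < e%:C by rewrite ltcR.
have [N1 _ N1P] := (cvgrPdist_lt _ _).1 sp _ e0'.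
have [N2 N2P] := small e e0.
have := N1P (maxn N1 N2) (leq_maxl _ _); rewrite /= real_normE ltcR.
have := N2P (maxn N1 N2) (leq_maxr _ _).
have [_] := sP (maxn N1 N2).
set m := maxn N1 N2; rewrite -/m; set v := s m; set i := m.+1%:R^-1 => h1 h2.
set c := nr (p - v) => h3.
have : a <= nr (w - v) + c.
  rewrite /a; have -> : w - p = (w - v) + (v - p) by rewrite addrA subrK.
  by rewrite (le_trans (ler_real_normD _ _)) // lerD2l /nr /c /nr distrC.
have b0 := real_norm_ge0 (w - v).
move: (nr (w - v)) b0 h1 => b b0 h1 h4.
move: i h1 h2 => i h1 h2; clearbody e c d; have [ae|ea] := ltP a e.
  by have := sqr_ge0 b; nra.
have : (a - e) ^+ 2 <= b ^+ 2 by rewrite ler_pXn2r ?nnegrE ?subr_ge0 //; lra.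
by move=> h5; nra.
Unshelve. all: by end_near.
Qed.

(** Moving the closest point [p] inside [K] along [y] cannot shorten [w - p], which forces [w - p]
    to be orthogonal to [y]. *)
Lemma orthogonal_projection (K : set H) (w : H) : closed K -> K 0 ->
  (forall a x y, K x -> K y -> K (a *: x + y)) ->
  exists2 p, K p & orthogonal_complement dot K (w - p).
Proof.
move=> Kcl K0 Klin; have [p Kp pmin] := closest_point w Kcl K0 Klin.
exists p => // y Ky; set u := w - p.
pose Y := dot y y; have Y0 : 0 <= Y by exact: dnorm_ge0.
pose P := `|dot u y| ^+ 2; have P0 : 0 <= P by rewrite exprn_ge0.
have Y1 : 0 < Y + 1 by rewrite ltr_wpDl.
(* Nearly the optimal coefficient [dot u y / Y]; the added 1 avoids a separate case [y = 0]. The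
   squared norm changes by [- P * (Y + 2) / (Y + 1) ^+ 2], hence [P = 0]. *)
pose c := (Y + 1)^-1 * dot u y.
have [_ dotC _] := dot_psd.
have cE : - c * dot y u = - ((Y + 1)^-1 * P).
  by rewrite (dotC u y) /P normCK /c; ring.
have cN : `|- c| ^+ 2 = (Y + 1)^-1 ^+ 2 * P.
  by rewrite normrN /c normrM exprMn [`|(Y + 1)^-1|]ger0_norm ?invr_ge0 ?(ltW Y1).
have tP_real : (- ((Y + 1)^-1 * P))^*%R = - ((Y + 1)^-1 * P).
  apply/CrealP; rewrite realN ger0_real // mulr_ge0 // invr_ge0 ltW //.
have : dot u u <= dot (- c *: y + u) (- c *: y + u).
  rewrite !dot_real_norm lecR ler_pXn2r ?nnegrE ?real_norm_ge0 //.
  have -> : - c *: y + u = w - (c *: y + p) by rewrite scaleNr opprD addrCA.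
  exact: pmin (Klin _ _ _ Ky Kp).
rewrite (psd_form_combination dot_psd) cE cN tP_real -/Y lerDr.
have -> : (Y + 1)^-1 ^+ 2 * P * Y - (Y + 1)^-1 * P - (Y + 1)^-1 * P =
    - (P * (Y + 2) * (Y + 1)^-1 ^+ 2) by field; rewrite gt_eqF.
rewrite oppr_ge0 pmulr_lle0 ?exprn_gt0 ?invr_gt0 // pmulr_lle0 ?ltr_wpDl //.
move=> P_le0; have : P == 0 by rewrite eq_le P_le0 P0.
by rewrite sqrf_eq0 normr_eq0 => /eqP.
Qed.

(** A nonzero [f] has a vector [u] orthogonal to its kernel with [f u] nonzero. Each
    [x - (f x / f u) *: u] is in the kernel, so [f] is determined by the inner product with [u]. *)
Lemma Riesz_representation (f : H -> R[i]) (D : R) : scalar f ->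
  (forall x, `|f x| <= (D * nr x)%:C) -> exists z, forall x, f x = dot x z.
Proof.
move=> flin fD.
have fB : {morph f : x y / x - y}.
  by move=> x y; rewrite addrC -scaleN1r flin mulN1r addrC.
have f0 : f 0 = 0 by rewrite -(subrr 0) fB subrr.
have [fz|/existsNP[w fw]] := pselect (forall x, f x = 0).
  by exists 0 => x; rewrite linear0r fz.
have Kcl : closed [set x | f x = 0] by exact: closed_kernel fB fD.
have [|a x y /= fx fy|p /= fp up] := orthogonal_projection w Kcl; first exact: f0.
  by rewrite flin fx fy mulr0 addr0.
set u := w - p in up.
have fu : f u != 0 by rewrite fB fp subr0; exact/eqP.
have u0 : dot u u != 0.
  rewrite dnorm_eq0; apply: contraNneq fu => ->; exact/eqP.
have [_ dotC _] := dot_psd.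
(* The multiple [z] of [u] with [dot u z = f u]; [dot] is conjugate-linear in its second
   argument. *)
exists (((f u)^*%R / dot u u) *: u) => x.
have : dot u (- (f x / f u) *: u + x) = 0.
  by apply: up; rewrite /= flin mulNr divfK // addNr.
rewrite dotC => /eqP; rewrite conjC_eq0 linearPl.
rewrite mulNr addrC subr_eq0 => /eqP xu.
rewrite linearZr_LR /= xu rmorphM /= conjCK fmorphV /= -dotC.
by field; rewrite u0 fu.
Qed.

Lemma adjointP (T : H -> H) : bounded_operator T ->
  forall x y, dot (T x) y = dot x (adjoint dot T y).
Proof.
move=> Tbd x y; move: x; rewrite /adjoint.
have [D D0 TD] := bounded_operator_real Tbd.
apply: (xgetPex 0 (P := [set z | forall x, dot (T x) y = dot x z])).
apply: (@Riesz_representation (fun x => dot (T x) y) (D * nr y)).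
  by move=> a u v; rewrite Tbd.1 linearPl.
move=> x; apply: le_trans (norm_dot_le _ _) _.
by rewrite lecR mulrAC ler_wpM2r ?real_norm_ge0 // TD.
Qed.

(** For [y = A v], removing from [v] its projection on the kernel gives an admissible value, so
    [xget] does not return its default. For any admissible [x], [y - A x] is both in the range and
    orthogonal to it. *)
Lemma moore_penroseP (A : H -> H) : bounded_operator A ->
  forall y, range A y -> A (moore_penrose dot A y) = y.
Proof.
move=> Abd _ [v _ <-]; have [Alin _] := Abd; have [D D0 AD] := bounded_operator_real Abd.
have AB : {morph A : x y / x - y}.
  by move=> x y; rewrite addrC -scaleN1r Alin scaleN1r addrC.
have A0 : A 0 = 0 by rewrite -{1}(subrr 0) AB subrr.
have Kcl : closed [set x | A x = 0].
  by apply: closed_kernel AB _ => x; rewrite real_normE lecR; exact: AD.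
have [|a x y /= Ax Ay|p /= Ap vp] := orthogonal_projection v Kcl; first exact: A0.
  by rewrite Alin Ax Ay scaler0 addr0.
rewrite /moore_penrose; case: xgetP => [x _ /= [_ xP]|/(_ (v - p))[]].
  apply/eqP; rewrite eq_sym -subr_eq0 -(dnorm_eq0 dot); apply/eqP.
  by apply: xP; exists (v - x) => //; rewrite AB.
split; first exact: vp.
by move=> y _; rewrite AB Ap subr0 subrr linear0l.
Qed.

End HilbertSpaces.

(** * Real sequences, finite sums and suprema *)

Section RealInequalities.
Variable R : realType.

(** Log-convexity makes the ratios of consecutive terms nondecreasing. If the first ratio [r]
    exceeded [D], then [r ^+ n * a 0] would outgrow [K * D ^+ n]. *)
Lemma log_convex_growth (a : nat -> R) (K D : R) : 0 < D ->
  (forall n, 0 <= a n) -> (forall n, a n.+1 ^+ 2 <= a n * a n.+2) ->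
  (forall n, a n <= K * D ^+ n) -> a 1%N <= D * a 0%N.
Proof.
move=> D0 a0 aconv aK; rewrite leNgt; apply/negP => lt.
have a0_gt0 : 0 < a 0%N.
  rewrite lt_def a0 andbT; apply/eqP => az.
  by have := aconv 0%N; have := a0 1%N; rewrite az in lt *; nra.
pose r := a 1%N / a 0%N.
have rD : D < r by rewrite ltr_pdivlMr.
have r0 : 0 < r by exact: lt_trans rD.
have step n : 0 < a n /\ r * a n <= a n.+1.
  elim: n => [|n [an_gt0 IH]]; first by rewrite /r divfK ?gt_eqF.
  have an1 : 0 < a n.+1 by apply: lt_le_trans IH; rewrite mulr_gt0.
  split=> //; rewrite -(ler_pM2l an_gt0) (le_trans _ (aconv n)) //.
  by rewrite mulrA [a n * r]mulrC expr2 ler_pM2r.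
have growth n : r ^+ n * a 0%N <= a n.
  elim: n => [|n IH]; first by rewrite expr0 mul1r.
  rewrite exprS -mulrA (le_trans _ (step n).2) // ler_pM2l //.
have K0 : 0 < K by have := aK 0%N; rewrite expr0 mulr1; exact: lt_le_trans.
have Dr : 0 <= D / r by rewrite divr_ge0 ?ltW.
have /cvgrPdist_lt/(_ (a 0%N / K)) : (fun n => (D / r) ^+ n) @ \oo --> 0.
  by apply: cvg_expr; rewrite ger0_norm // ltr_pdivrMr ?mul1r.
move=> /(_ (divr_gt0 a0_gt0 K0)) [N _ /(_ N (leqnn N))] /=.
rewrite sub0r normrN ger0_norm ?exprn_ge0 // ltNge => /negP; apply.
rewrite expr_div_n ler_pdivrMr // mulrAC ler_pdivlMr ?exprn_gt0 //.
by rewrite mulrC [_ * K]mulrC (le_trans (growth N)).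
Qed.

(** Cauchy-Schwarz against the constant vector, obtained from the nonnegativity of the sum of
    squared deviations from the mean [m]. *)
Lemma sum_le_sqrt_sum_sqr (n : nat) (a : 'I_n -> R) : (0 < n)%N ->
  \sum_k a k <= Num.sqrt n%:R * Num.sqrt (\sum_k a k ^+ 2).
Proof.
move=> n0; have n0' : 0 < n%:R :> R by rewrite ltr0n.
pose s := \sum_k a k.
have s2 : s ^+ 2 <= n%:R * \sum_k a k ^+ 2.
  pose m := s / n%:R.
  have : 0 <= \sum_k (a k - m) ^+ 2 by apply: sumr_ge0 => k _; exact: sqr_ge0.
  under eq_bigr do rewrite sqrrB.
  rewrite big_split /= sumrB sumrMnl -mulr_suml -/s sumr_const card_ord.
  have sE : s = m * n%:R by rewrite /m divfK ?gt_eqF.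
  rewrite -[m ^+ 2 *+ n]mulr_natr sE => h.
  have -> : (m * n%:R) ^+ 2 = n%:R * (m ^+ 2 * n%:R) by ring.
  by rewrite ler_pM2l //; move: h; rewrite mulr2n; lra.
rewrite -sqrtrM ?ler0n // (le_trans (ler_norm _)) // -sqrtr_sqr ler_wsqrtr //.
Qed.

Lemma sup_nonneg (E : set R) : (forall y, E y -> 0 <= y) -> 0 <= sup E.
Proof.
move=> E0; have [[Ex Eub]|/sup_out ->//] := pselect (has_sup E).
by have [y Ey] := Ex; apply: le_trans (E0 _ Ey) _; exact: ub_le_sup.
Qed.

End RealInequalities.

(** * The semi-inner product of [A] and [A]-bounded operators *)

Section AForm.
Variables (R : realType) (H : completeNormedModType R[i]).
Variable dot : {dot H for Num.conj}.
Hypothesis hilbertH : is_hilbert dot.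
Variable A : H -> H.
Hypothesis posA : positive_operator dot A.

Local Notation q := (A_dot dot A).
Local Notation sq x := (complex.Re (q x x)).
Local Notation modulus z := (complex.Re `|z|).

(* Polarization: <Ax, x> is real for every x, so A is self-adjoint. *)
Lemma A_dot_psd : psd_form q.
Proof.
have [[Alin _] Apos] := posA.
have AD : {morph A : x y / x + y}.
  by move=> x y; rewrite -[x]scale1r Alin !scale1r.
have A0 : A 0 = 0.
  have := congr1 (fun v => v - A 0) (Alin 1 0 0).
  by rewrite !scale1r addr0 addrK subrr.
have AZ a x : A (a *: x) = a *: A x by rewrite -[a *: x]addr0 Alin A0 addr0.
split=> [y a x z|x y|x]; [by rewrite /A_dot Alin linearPl| |exact: Apos].
have real z : (dot (A z) z)^*%R = dot (A z) z by apply/CrealP; rewrite ger0_real ?Apos.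
have expand a : dot (A (a *: x + y)) (a *: x + y) =
    a * a^*%R * dot (A x) x + a * dot (A x) y + a^*%R * dot (A y) x + dot (A y) y.
  rewrite AD AZ !linearDl !linearDr !linearZl_LR !linearZr_LR /=.
  by rewrite -![_ *: _]/(_ * _); ring.
rewrite /A_dot; set r := dot (A y) x; set p := dot (A x) y.
(* Reality at [x + y] makes [p + r] real, and at ['i *: x + y] makes ['i * (p - r)] real; together
   they give [p = r^*]. *)
have := real (1 *: x + y); have := real ('i *: x + y); rewrite !expand -/r -/p.
rewrite !(rmorphD, rmorphM) /= !conjCK !real conjCi rmorph1 => h1 h2.
have e1 : p^*%R + r^*%R = p + r.
  by apply/eqP; rewrite -subr_eq0; move/eqP: h2; rewrite -subr_eq0; congr (_ == 0); ring.
have e2 : r^*%R - p^*%R = p - r.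
  apply: (mulfI (neq0Ci _)); apply/eqP; rewrite -subr_eq0.
  by move/eqP: h1; rewrite -subr_eq0; congr (_ == 0); ring.
suff -> : p = r^*%R by rewrite conjCK.
have n2 : 2 != 0 :> R[i] by rewrite pnatr_eq0.
apply: (mulfI n2); transitivity ((p + r) + (p - r)); first by ring.
by rewrite -e1 -e2; ring.
Qed.

Let A_dot_ge0 x : 0 <= q x x.
Proof. exact: posA.2. Qed.

Lemma A_dot_sq x : q x x = (sq x)%:C.
Proof. by rewrite RRe_real // ger0_real. Qed.

Lemma sq_ge0 x : 0 <= sq x.
Proof. by rewrite -ler0c -A_dot_sq. Qed.

Lemma modulusE (z : R[i]) : `|z| = (modulus z)%:C.
Proof. by rewrite RRe_real ?normr_real. Qed.

Lemma modulus_ge0 (z : R[i]) : 0 <= modulus z.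
Proof. by rewrite -ler0c -modulusE. Qed.

Lemma modulusD (z w : R[i]) : modulus (z + w) <= modulus z + modulus w.
Proof. by rewrite -lecR rmorphD /= -!modulusE ler_normD. Qed.

Lemma modulus_A_dot_sq x : modulus (q x x) = sq x.
Proof. by rewrite ger0_norm. Qed.

Lemma A_Cauchy_Schwarz x y : modulus (q x y) ^+ 2 <= sq x * sq y.
Proof.
have := psd_form_Cauchy_Schwarz A_dot_psd x y.
by rewrite -lecR rmorphXn rmorphM /= -modulusE -!A_dot_sq.
Qed.

Lemma A_norm1 x : A_norm dot A x = 1 -> sq x = 1.
Proof.
move=> x1; have := congr1 (fun r => r ^+ 2) x1.
by rewrite /A_norm sqr_sqrtr ?sq_ge0 // expr1n.
Qed.

Lemma A_self_adjoint x y : dot (A x) y = dot x (A y).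
Proof.
have [_ qC _] := A_dot_psd; have [_ dC _] := dot_psd dot.
by rewrite -/(q x y) (qC y x) /A_dot -dC.
Qed.

(** Since [adjoint dot T (A y) = A (W y)] lies in the range of [A], the Moore-Penrose inverse is a
    true preimage there, and [A] composed with [A_adjoint dot A T] is [adjoint dot T \o A]. *)
Lemma A_bounded_swap (T : H -> H) : A_bounded dot A T ->
  forall x y, q (T x) y = q x (A_adjoint dot A T y).
Proof.
move=> [Tbd [W [_ AW]]] x y.
have mp : A (A_adjoint dot A T y) = adjoint dot T (A y).
  rewrite /A_adjoint /= moore_penroseP //; first by case: posA.
  by exists (W y) => //; rewrite -[LHS]/((A \o W) y) AW.
by rewrite /A_dot A_self_adjoint (adjointP hilbertH Tbd) A_self_adjoint mp.
Qed.

(* Krein's argument: if A W = T^* A, then V = W T is A-symmetric, so n |-> |V^n x|_A^2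
   is log-convex, while boundedness of V makes it grow at most geometrically. *)
Lemma A_bounded_seminorm (T : H -> H) : A_bounded dot A T ->
  exists2 c : R, 0 <= c & forall x, sq (T x) <= c * sq x.
Proof.
move=> [Tbd [W [Wbd AW]]].
have [_ qC _] := A_dot_psd.
have TW x y : q (T x) y = q x (W y).
  have AWy := congr1 (fun f => f y) AW.
  rewrite /A_dot A_self_adjoint (adjointP hilbertH Tbd) A_self_adjoint.
  by rewrite -[LHS]/(dot x ((adjoint dot T \o A) y)) -AWy.
pose V := W \o T.
have VV x y : q (V x) y = q x (V y) by rewrite (qC y) /V /= -TW -qC TW.
have [DA DA0 ADA] := bounded_operator_real (proj1 posA).
have [DT DT0 TDT] := bounded_operator_real Tbd.
have [DW DW0 WDW] := bounded_operator_real Wbd.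
(* [DW * DT] bounds [V]; adding 1 makes the growth rate positive, as [log_convex_growth]
   requires. *)
pose D := DW * DT + 1.
have D0 : 0 < D by rewrite ltr_wpDl ?mulr_ge0.
have VD x n : real_norm (iter n V x) <= D ^+ n * real_norm x.
  elim: n => [|n IH]; first by rewrite expr0 mul1r.
  rewrite exprS -mulrA (@le_trans _ _ (D * real_norm (iter n V x))) //; last by rewrite ler_pM2l.
  apply: le_trans (WDW _) _.
  rewrite (@le_trans _ _ (DW * (DT * real_norm (iter n V x)))) ?ler_wpM2l //.
  by rewrite mulrA ler_wpM2r ?real_norm_ge0 // lerDl.
have sqD x : sq x <= DA * real_norm x ^+ 2.
  rewrite -lecR -A_dot_sq -[q x x]ger0_norm //.
  apply: le_trans (norm_dot_le hilbertH _ _) _.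
  by rewrite lecR expr2 mulrA ler_wpM2r ?real_norm_ge0.
have sqV x : sq (V x) <= D ^+ 2 * sq x.
  apply: (@log_convex_growth _ (fun n => sq (iter n V x)) (DA * real_norm x ^+ 2)) => [|n|n|n].
  - exact: exprn_gt0.
  - exact: sq_ge0.
  (* By symmetry of [V], the form at [iter n V x] and [iter n.+2 V x] is [sq (iter n.+1 V x)]. *)
  - have := A_Cauchy_Schwarz (iter n V x) (iter n.+2 V x).
    by rewrite [iter n.+2 V x]iterS -VV modulus_A_dot_sq.
  - apply: le_trans (sqD _) _; rewrite -mulrA ler_wpM2l // mulrC exprAC -exprMn.
    by rewrite ler_pXn2r ?nnegrE ?mulr_ge0 ?exprn_ge0 ?real_norm_ge0 ?(ltW D0).
exists D => [|x]; first exact: ltW.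
rewrite -(@ler_pXn2r _ 2) ?nnegrE ?mulr_ge0 ?sq_ge0 ?(ltW D0) //.
(* Back from [V] to [T]: [sq (T x)] is the form at [x] and [V x], so its square is at most
   [sq x * (D ^+ 2 * sq x)]. *)
have := A_Cauchy_Schwarz x (V x).
rewrite (_ : q x (V x) = q (T x) (T x)); last by rewrite TW.
rewrite modulus_A_dot_sq => /le_trans; apply.
have -> : (D * sq x) ^+ 2 = sq x * (D ^+ 2 * sq x) by ring.
by rewrite ler_wpM2l ?sq_ge0.
Qed.

(** [sq (S x)] equals the form at [T (S x)] and [x]; Cauchy-Schwarz and the bound for [T] leave a
    factor [sq (S x)] to cancel, so the constant of [T] serves for [S]. *)
Lemma A_adjoint_seminorm (T : H -> H) : A_bounded dot A T ->
  exists2 c : R, 0 <= c & forall x, sq (A_adjoint dot A T x) <= c * sq x.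
Proof.
move=> TB; have [c c0 Tc] := A_bounded_seminorm TB; exists c => // x.
set S := A_adjoint dot A T.
have [Sx0|Sx0] := eqVneq (sq (S x)) 0; first by rewrite Sx0 mulr_ge0 ?sq_ge0.
have Sx_gt0 : 0 < sq (S x) by rewrite lt_def Sx0 sq_ge0.
have := A_Cauchy_Schwarz (T (S x)) x.
rewrite (A_bounded_swap TB) -/S modulus_A_dot_sq => h.
rewrite -(ler_pM2l Sx_gt0) -expr2 (le_trans h) // mulrCA mulrA ler_wpM2r ?sq_ge0 //.
Qed.

Lemma A_dotZl (a : R[i]) (x y : H) : q (a *: x) y = a * q x y.
Proof.
have [qlin _ _] := A_dot_psd; have := qlin y a x 0; rewrite /= addr0 => ->.
have := congr1 (fun z => z - q 0 y) (qlin y 1 0 0).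
by rewrite /= scale1r mul1r addr0 addrK subrr => <-; rewrite addr0.
Qed.

(** Buzano's bound is taken [alpha / 4] times and the Cauchy-Schwarz bound [beta] times. The term
    [sq (T x)], which comes from [S \o T], occurs in both and gets weight [alpha / 4 + beta];
    [sq (S x)], from [T \o S], occurs only in Buzano's. *)
Lemma A_power_inequality (T : H -> H) (S := A_adjoint dot A T) (alpha beta : R) (x : H) :
  A_bounded dot A T -> 0 <= alpha -> 0 <= beta -> sq x = 1 ->
  (alpha + beta) * modulus (q (T x) x) ^+ 2 <=
    modulus (q ((alpha / 4 + beta)%:C *: S (T x) + (alpha / 4)%:C *: T (S x)) x)
    + alpha / 2 * modulus (q (T (T x)) x).
Proof.
move=> TB alpha0 beta0 x1.
have swap := A_bounded_swap TB; have [qlin qC _] := A_dot_psd.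
have STx : q (S (T x)) x = (sq (T x))%:C by rewrite qC -swap -qC A_dot_sq.
have TSx : q (T (S x)) x = (sq (S x))%:C by rewrite swap A_dot_sq.
set g := alpha / 4 + beta; have g0 : 0 <= g by rewrite addr_ge0 // divr_ge0.
have a0 : 0 <= alpha / 4 by rewrite divr_ge0.
have -> : modulus (q (g%:C *: S (T x) + (alpha / 4)%:C *: T (S x)) x) =
    g * sq (T x) + alpha / 4 * sq (S x).
  have -> : q (g%:C *: S (T x) + (alpha / 4)%:C *: T (S x)) x =
      (g * sq (T x) + alpha / 4 * sq (S x))%:C.
    have := qlin x g%:C (S (T x)) ((alpha / 4)%:C *: T (S x)).
    rewrite /= A_dotZl STx TSx => ->.
    by rewrite [RHS]rmorphD; congr (_ + _); rewrite [RHS]rmorphM.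
  by rewrite ger0_norm //= ler0c addr_ge0 // mulr_ge0 ?sq_ge0.
have t1 : modulus (q (T x) x) ^+ 2 <= sq (T x).
  by have := A_Cauchy_Schwarz (T x) x; rewrite x1 mulr1.
have q1 : q x x = 1 by rewrite A_dot_sq x1.
have B : 4 * modulus (q (T x) x) ^+ 2 <=
    sq (T x) + sq (S x) + 2 * modulus (q (T (T x)) x).
  (* With [e = x], swapping turns [q x (S x)] into [q (T x) x] and [q (T x) (S x)] into
     [q (T (T x)) x]. *)
  have := psd_form_Buzano A_dot_psd (T x) (S x) q1.
  rewrite -[q x (S x)]swap -[q (T x) (S x)]swap -expr2 normrX !expr2.
  rewrite [q (T x) (T x)]A_dot_sq [q (S x) (S x)]A_dot_sq.
  rewrite [`|q (T x) x|]modulusE [`|q (T (T x)) x|]modulusE.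
  move: (modulus (q (T x) x)) (modulus (q (T (T x)) x)).
  move: (sq (T x)) (sq (S x)) => u v t p h.
  by rewrite -lecR 2!rmorphD 3!rmorphM 2!rmorph_nat.
move: (ler_wpM2l a0 B) (ler_wpM2l beta0 t1); rewrite /g.
move: (modulus (q (T x) x)) (modulus (q (T (T x)) x)) (sq (T x)) (sq (S x)) => t p u v.
by move=> h1 h2; lra.
Qed.

(** For every component of a tuple, this bounds the set whose supremum is [omega]. *)
Definition numerically_bounded (T : H -> H) : Prop :=
  exists c : R, forall x, sq x = 1 -> modulus (q (T x) x) <= c.

Lemma numerically_boundedD (S T : H -> H) :
  numerically_bounded S -> numerically_bounded T -> numerically_bounded (S + T).
Proof.
move=> [c Sc] [d Td]; exists (c + d) => x x1.
have [qlin _ _] := A_dot_psd.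
have -> : q ((S + T) x) x = q (S x) x + q (T x) x.
  by have := qlin x 1 (S x) (T x); rewrite scale1r mul1r.
by apply: le_trans (modulusD _ _) _; rewrite lerD ?Sc ?Td.
Qed.

Lemma numerically_boundedZ (a : R) (T : H -> H) : 0 <= a ->
  numerically_bounded T -> numerically_bounded (a%:C *: T).
Proof.
move=> a0 [c Tc]; exists (a * c) => x x1.
rewrite A_dotZl normrM [`|a%:C|]ger0_norm ?ler0c //.
by rewrite modulusE -rmorphM /= ler_wpM2l ?Tc.
Qed.

Lemma A_bounded_numerically_bounded (T : H -> H) (S := A_adjoint dot A T) :
  A_bounded dot A T ->
  [/\ numerically_bounded T, numerically_bounded (T \o T),
      numerically_bounded (S \o T) & numerically_bounded (T \o S)].
Proof.
move=> TB.
have [_ qC _] := A_dot_psd; have swap := A_bounded_swap TB.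
have [c c0 Tc] := A_bounded_seminorm TB.
have [d d0 Sd] := A_adjoint_seminorm TB.
(* A crude bound suffices for finiteness and avoids square roots. *)
have root (t u v : R) : 0 <= u -> 0 <= v -> t ^+ 2 <= u * v -> t <= u + v.
  by move=> u0 v0 tuv; rewrite leNgt; apply/negP => lt; nra.
have CS := A_Cauchy_Schwarz; have sq0 := sq_ge0.
have bound (y : H) (b : R) x : sq x = 1 -> sq y <= b * sq x -> sq y <= b.
  by move=> ->; rewrite mulr1.
split.
- exists (c + 1) => x x1.
  apply: le_trans (root _ _ _ (sq0 _) (sq0 _) (CS (T x) x)) _.
  by rewrite x1 lerD2r; exact: bound (Tc x).
- exists (c + d) => x x1; rewrite [(T \o T) x]/comp swap.
  apply: le_trans (root _ _ _ (sq0 _) (sq0 _) (CS (T x) (S x))) _.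
  by rewrite lerD //; [exact: bound (Tc x)|exact: bound (Sd x)].
- exists c => x x1; rewrite [(S \o T) x]/comp qC -swap -qC modulus_A_dot_sq //.
  exact: bound (Tc x).
- exists d => x x1; rewrite [(T \o S) x]/comp swap modulus_A_dot_sq //.
  exact: bound (Sd x).
Qed.

(** * Upper and lower estimates of [omega] for tuples *)

Variable n : nat.

Definition tuple_modulus (X : 'I_n -> H -> H) (x : H) : R :=
  Num.sqrt (\sum_(k < n) modulus (q (X k x) x) ^+ 2).

Lemma tuple_modulus_le_omega (X : 'I_n -> H -> H) :
  (forall k, numerically_bounded (X k)) ->
  forall x, A_norm dot A x = 1 -> tuple_modulus X x <= omega dot A X.
Proof.
move=> Xbd x x1.
have [c cP] : {c : 'I_n -> R & forall k x, sq x = 1 -> modulus (q (X k x) x) <= c k}.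
  exact: (@choice _ _ (fun k c => forall x, sq x = 1 -> modulus (q (X k x) x) <= c)) Xbd.
apply: ub_le_sup; last by exists x.
exists (Num.sqrt (\sum_(k < n) c k ^+ 2)) => _ [y /A_norm1 y1 <-].
rewrite ler_wsqrtr //; apply: ler_sum => k _.
by rewrite lerXn2r ?nnegrE ?modulus_ge0 ?(le_trans (modulus_ge0 _) (cP k y y1)) ?cP.
Qed.

Lemma omega_ge0 (X : 'I_n -> H -> H) : 0 <= omega dot A X.
Proof. by apply: sup_nonneg => _ [x _ <-]; exact: sqrtr_ge0. Qed.

(** [0 <= b] covers the case where no [x] has seminorm 1 and the supremum is 0. *)
Lemma omega_le (X : 'I_n -> H -> H) (b : R) : 0 <= b ->
  (forall x, A_norm dot A x = 1 -> tuple_modulus X x <= b) -> omega dot A X <= b.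
Proof.
move=> b0 Xb; rewrite /omega; set E := image _ _.
have [/set0P E0|/negPn/eqP ->] := boolP (E != set0); last by rewrite sup0.
by apply: ge_sup E0 _ => _ [y y1 <-]; exact: Xb.
Qed.

Lemma omega_scale (X : 'I_n -> H -> H) (a : R) : 0 <= a ->
  (forall k, numerically_bounded (X k)) ->
  omega dot A (a%:C *: X) <= a * omega dot A X.
Proof.
move=> a0 Xbd; apply: omega_le => [|x x1]; first by rewrite mulr_ge0 ?omega_ge0.
apply: le_trans (ler_wpM2l a0 (tuple_modulus_le_omega Xbd x1)).
rewrite /tuple_modulus -[a in leRHS]ger0_norm // -sqrtr_sqr -sqrtrM ?sqr_ge0 //.
rewrite mulr_sumr ler_wsqrtr //; apply: ler_sum => k _.
by rewrite -exprMn A_dotZl normrM [`|a%:C|]ger0_norm ?ler0c // modulusE -rmorphM.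
Qed.

End AForm.

(** * The two inequalities *)

Theorem corollary3p22 (R : realType) (H : completeNormedModType R[i])
    (dot : {dot H for Num.conj}) (hilbertH : is_hilbert dot)
    (nontrivialH : exists x : H, x != 0)
    (A : H -> H) (posA : positive_operator dot A)
    (n : nat) (n_ge1 : (1 <= n)%N)
    (T : 'I_n -> H -> H) (TB : forall k, A_bounded dot A (T k)) :
  let Ts := tuple_A_adjoint dot A T in
  let TsT := tuple_mul Ts T in
  let TTs := tuple_mul T Ts in
  let w := @omega R H dot n A in
  let bound (alpha beta : R) : R :=
    Num.sqrt n%:R / (alpha + beta) *
      (w ((alpha / 4 + beta)%:C *: TsT + (alpha / 4)%:C *: TTs)
       + alpha / 2 * w (tuple_mul T T)) in
  let infimum : R :=
    inf [set bound p.1 p.2 | p in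
          [set p : R * R | [/\ 0 <= p.1, 0 <= p.2 & p <> (0, 0)]]] in
  w T ^+ 2 <= infimum /\
  infimum <= Num.sqrt n%:R *
    (1 / 4 * w (TsT + TTs) + 1 / 2 * w (tuple_mul T T)).
Proof.
move=> Ts TsT TTs w bound infimum.
have nb k := A_bounded_numerically_bounded hilbertH posA (TB k).
have nb_comb (a b : R) : 0 <= a -> 0 <= b ->
    forall k, numerically_bounded dot A ((a%:C *: TsT + b%:C *: TTs) k).
  move=> a0 b0 k; have [_ _ bST bTS] := nb k.
  by apply: (numerically_boundedD posA); exact: (numerically_boundedZ posA).
pose D : set (R * R) := [set p | [/\ 0 <= p.1, 0 <= p.2 & p <> (0, 0)]].
have sn0 : 0 <= Num.sqrt n%:R :> R by exact: sqrtr_ge0.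
have w0 X : 0 <= w X by exact: omega_ge0.
have main p : D p -> w T ^+ 2 <= bound p.1 p.2.
  case: p => alpha beta [/= alpha0 beta0 ne0].
  have s0 : 0 < alpha + beta.
    rewrite lt_def addr_ge0 // andbT; apply: contra_notN ne0.
    by rewrite paddr_eq0 // => /andP[/eqP -> /eqP ->].
  rewrite /bound; set X := (_ *: TsT + _).
  set b := _ * (w X + _).
  have b0 : 0 <= b by rewrite mulr_ge0 ?divr_ge0 ?addr_ge0 ?mulr_ge0 ?divr_ge0 // ltW.
  (* Writing [b] as the square of its root reduces the claim to a pointwise bound under the
     supremum. *)
  rewrite -[b]sqr_sqrtr // ler_pXn2r ?nnegrE ?sqrtr_ge0 //.
  apply: omega_le => [|x x1]; first exact: sqrtr_ge0.
  rewrite /tuple_modulus ler_wsqrtr // -(ler_pM2l s0).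
  have -> : (alpha + beta) * b = Num.sqrt n%:R * (w X + alpha / 2 * w (tuple_mul T T)).
    by rewrite /b; field; rewrite gt_eqF.
  have x1' := A_norm1 posA x1.
  rewrite mulr_sumr.
  apply: le_trans (ler_sum _ (fun k _ => A_power_inequality hilbertH posA (TB k) alpha0 beta0 x1')) _.
  rewrite big_split /= -mulr_sumr mulrDr; apply: lerD.
    apply: le_trans (sum_le_sqrt_sum_sqr _ n_ge1) _; rewrite ler_wpM2l //.
    apply: tuple_modulus_le_omega x1 => // k.
    by apply: nb_comb; rewrite ?addr_ge0 ?divr_ge0.
  rewrite mulrCA ler_wpM2l ?divr_ge0 //.
  apply: le_trans (sum_le_sqrt_sum_sqr _ n_ge1) _; rewrite ler_wpM2l //.
  by apply: tuple_modulus_le_omega x1 => // k; case: (nb k).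
(* This pair shows that the infimum is over a nonempty set, and its bound yields the second
   inequality once 1/4 is taken out of [omega]. *)
have D10 : D (1, 0) by split=> //= -[/eqP]; rewrite oner_eq0.
split.
  apply: lb_le_inf; first by exists (bound 1 0), (1, 0).
  by move=> _ [p Dp <-]; exact: main.
apply: le_trans (ge_inf _ (_ : _ (bound 1 0))) _.
- by exists (w T ^+ 2) => _ [p Dp <-]; exact: main.
- by exists (1, 0).
rewrite /bound !addr0 divr1 ler_wpM2l // lerD2r -scalerDr.
apply: (omega_scale posA) => [|k]; first by rewrite divr_ge0.
have [_ _ bST bTS] := nb k; exact: (numerically_boundedD posA).
Qed.
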